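(* Let $D\subset\mathbb{R}^n$ be an arbitrary bounded set, let $R$ be any number greater than or equal to the diameter of $D$ with $D\subset B(0,R)\subset\mathbb{R}^n$, and let $V_n$ be the volume of the $n$-dimensional unit sphere. Let $\chi_D$ be the indicator function of $D$, and define $$\Omega_D(z)=\sup_{x,\xi}\chi_D(x)\int_z^\infty\int_{\mathbb{R}^n}e^{-|x+s\xi-s\xi_*|^2-|\xi_*|^2}|\xi-\xi_*|\,d\xi_*\,ds,$$ $$\Omega=\sup_{x,\xi}\int_0^\infty\int_{\mathbb{R}^n}e^{-|x+s\xi-s\xi_*|^2-|\xi_*|^2}|\xi-\xi_*|\,d\xi_*\,ds,$$ with suprema over $x,\xi\in\mathbb{R}^n$. Then: (i) for all $z>1$, $$\Omega_D(z)\le\int_{\mathbb{R}^n}\int_{z/\log(z)-R}^\infty e^{-s^2-|\xi_*|^2}\,ds\,d\xi_*+V_n\frac{1}{\log^n(z)}\int_{-R}^\infty e^{-s^2}\,ds<\infty;$$ (ii) $\Omega<\infty$.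
   Context: $B(0,R)$ is the ball of radius $R$ centered at the origin; $\log^n(z)=(\log z)^n$. In this indexing $V_{n-1}$ is the volume (surface measure) of the $(n-1)$-dimensional unit sphere $S^{n-1}\subset\mathbb{R}^n$, and $V_n$ is that of the $n$-dimensional unit sphere. *)

(* Defs.v *)
From HB Require Import structures.
From mathcomp Require Import all_boot all_order all_algebra.
From mathcomp Require Import all_classical all_reals all_analysis.

Set Implicit Arguments.
Unset Strict Implicit.
Unset Printing Implicit Defensive.

Import Order.TTheory GRing.Theory Num.Theory.
Import numFieldNormedType.Exports.

Local Open Scope classical_set_scope.
Local Open Scope ring_scope.

(** R^n is ['rV[R]_n].  MathComp-Analysis norms matrices by the sup norm, so
    everything metric below goes through the Euclidean norm [enorm]. *)

Section euclidean.
Context {R : realType} {n : nat}.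
Implicit Types (x y : 'rV[R]_n) (r : R) (D : set 'rV[R]_n).

Definition enorm x : R := Num.sqrt (\sum_(i < n) x 0 i ^+ 2).

Definition eball x r : set 'rV[R]_n := [set y | enorm (x - y) < r].

(* [sup] is real valued, hence meaningful only for bounded D; it gives
   diameter 0 to the empty set. *)
Definition diam D : R := sup [set enorm (x - y) | x in D & y in D].

End euclidean.

(** The Borel sigma-algebra of R^n, generated by the coordinates. *)

Definition measure_rV_display : measure_display.
Proof. exact: default_measure_display. Qed.

Section measurable_rV.
Context {R : realType}.

Definition rV_coord n (i : 'I_n) (v : 'rV[R]_n) : measurableTypeR R := v 0 i.

Section instance.
Variable n : nat.

Let rV_set0 : g_sigma_preimage (@rV_coord n) set0.
Proof. exact: sigma_algebra0. Qed.

Let rV_setC A :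
  g_sigma_preimage (@rV_coord n) A -> g_sigma_preimage (@rV_coord n) (~` A).
Proof. exact: sigma_algebraC. Qed.

Let rV_bigcup (F : _^nat) : (forall i, g_sigma_preimage (@rV_coord n) (F i)) ->
  g_sigma_preimage (@rV_coord n) (\bigcup_i (F i)).
Proof. exact: sigma_algebra_bigcup. Qed.

HB.instance Definition _ := @isMeasurable.Build measure_rV_display
  'rV[R]_n (g_sigma_preimage (@rV_coord n)) rV_set0 rV_setC rV_bigcup.

End instance.

Lemma measurable_rV_coord n (i : 'I_n) :
  measurable_fun [set: 'rV[R]_n] (@rV_coord n i).
Proof.
move=> _ Y mY; rewrite setTI; apply: sub_sigma_algebra => /=.
rewrite -bigcup_seq/=; exists i => /=; first by rewrite mem_index_enum.
by exists Y => //; rewrite setTI.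
Qed.

Lemma measurable_fun_rV d (T : measurableType d) n (f : T -> 'rV[R]_n) :
  (forall i, measurable_fun [set: T] (@rV_coord n i \o f)) ->
  measurable_fun [set: T] f.
Proof.
move=> mf _ Y mY; rewrite setTI.
suff: g_sigma_preimage (fun i => @rV_coord n i \o f) `<=` measurable.
  apply; rewrite g_sigma_preimage_comp; exists Y => //; by rewrite setTI.
apply: smallest_sub; first exact: sigma_algebra_measurable.
case: n => [|n] in f mf Y mY *; first by rewrite big_ord0.
rewrite -bigcup_mkord_ord; apply: bigcup_sub => i Ii.
by move=> A [B mB <-]; exact: mf.
Qed.

End measurable_rV.

(** Lebesgue measure on R^n, as the n-fold product of Lebesgue measure on R. *)

Section lebesgue_rV.
Context {R : realType}.
Local Open Scope ereal_scope.

Definition rV_cons n (p : measurableTypeR R * 'rV[R]_n) : 'rV[R]_n.+1 :=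
  \row_i oapp (fun j => p.2 0 j)%R p.1 (unlift 0%R i).

Lemma measurable_rV_cons n : measurable_fun setT (@rV_cons n).
Proof.
apply: measurable_fun_rV => i.
have -> : rV_coord i \o @rV_cons n =
    fun p => oapp (fun j => p.2 0 j)%R p.1 (unlift 0%R i).
  by apply/funext => p; rewrite /rV_coord /= mxE.
case: (unlift _ _) => [j|] /=; last exact: measurable_fst.
exact: (measurableT_comp (measurable_rV_coord j) measurable_snd).
Qed.

Section step.
Variables (n : nat) (mu : {sigma_finite_measure set 'rV[R]_n -> \bar R}).

Definition lebesgue_step (A : set 'rV[R]_n.+1) : \bar R :=
  (@lebesgue_measure R \x mu) (@rV_cons n @^-1` A).

Let mpre (A : set 'rV[R]_n.+1) :
  measurable A -> measurable (@rV_cons n @^-1` A).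
Proof. by move=> mA; rewrite -[X in measurable X]setTI; apply: measurable_rV_cons. Qed.

Let step0 : lebesgue_step set0 = 0.
Proof. by rewrite /lebesgue_step preimage_set0 measure0. Qed.

Let step_ge0 A : 0 <= lebesgue_step A.
Proof. exact: measure_ge0. Qed.

Let step_sigma_additive : semi_sigma_additive lebesgue_step.
Proof.
move=> F mF tF mUF; rewrite /lebesgue_step preimage_bigcup.
apply: measure_semi_sigma_additive.
- by move=> k; exact: mpre.
- apply/trivIsetP => /= i j _ _ ij; rewrite -preimage_setI.
  by move/trivIsetP : tF => /(_ _ _ _ _ ij) ->//; rewrite preimage_set0.
- by rewrite -preimage_bigcup; exact: mpre.
Qed.

HB.instance Definition _ := isMeasure.Build _ _ _ lebesgue_step
  step0 step_ge0 step_sigma_additive.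

Let step_sigma_finite : sigma_finite setT lebesgue_step.
Proof.
have /sigma_finiteP[F [TF ndF Foo]] := sigma_finiteT (@lebesgue_measure R).
have /sigma_finiteP[G [TG ndG Goo]] := sigma_finiteT mu.
pose u (v : 'rV[R]_n.+1) : measurableTypeR R * 'rV[R]_n :=
  (v 0 0, \row_j v 0 (lift 0 j))%R.
have mu_ : measurable_fun setT u.
  apply/measurable_fun_pairP; split; first exact: (measurable_rV_coord 0%R).
  apply: measurable_fun_rV => i.
  rewrite (_ : _ \o _ = rV_coord (lift 0%R i)); last first.
    by apply/funext => v; rewrite /rV_coord /= mxE.
  exact: measurable_rV_coord.
exists (fun k => u @^-1` (F k `*` G k)).
  apply/seteqP; split => // v _.
  have : setT (u v).1 by [].
  have : setT (u v).2 by [].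
  rewrite TF TG => -[k _ Gk] [l _ Fl]; exists (maxn k l) => //; split.
  - by move: (u v).1 Fl; exact/subsetPset/ndF/leq_maxr.
  - by move: (u v).2 Gk; exact/subsetPset/ndG/leq_maxl.
move=> k; have [mF Fk] := Foo k; have [mG Gk] := Goo k; split.
  by rewrite -[X in measurable X]setTI; apply: mu_ => //; exact: measurableX.
rewrite /lebesgue_step -comp_preimage (_ : u \o _ = id).
  by rewrite product_measure1E// lte_mul_pinfty// ge0_fin_numE.
apply/funext => -[x v]; rewrite /u/= mxE unlift_none /=.
by congr pair; apply/rowP => j; rewrite !mxE liftK.
Qed.

HB.instance Definition _ := Measure_isSigmaFinite.Build _ _ _ lebesgue_step
  step_sigma_finite.

End step.

Fixpoint lebesgue_rV n : {sigma_finite_measure set 'rV[R]_n -> \bar R} :=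
  match n with
  | 0 => \d_(0%R : 'rV[R]_0)
  | m.+1 => lebesgue_step (lebesgue_rV m)
  end.

End lebesgue_rV.

Section lebesgue_rV_box.
Context {R : realType}.
Local Open Scope ereal_scope.

(* Characterizes [lebesgue_rV] among sigma-finite Borel measures. *)
Lemma lebesgue_rV_box n (A : 'I_n -> set R) :
  (forall i, measurable (A i : set (measurableTypeR R))) ->
  lebesgue_rV n [set v : 'rV[R]_n | forall i, A i (v 0%R i)] =
  \prod_(i < n) lebesgue_measure (A i).
Proof.
elim: n A => [|n ih] A mA.
  by rewrite big_ord0 /= diracE mem_set// => -[].
pose B := [set v : 'rV[R]_n | forall i, A (lift ord0 i) (v 0%R i)].
have mB : measurable B.
  rewrite (_ : B = \bigcap_(i in [set: 'I_n])
      (rV_coord i @^-1` (A (lift ord0 i) : set (measurableTypeR R)))); last first.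
    by apply/seteqP; split => [v Bv i _|v Bv i]; exact: Bv.
  apply: fin_bigcap_measurable => // i _.
  by rewrite -[X in measurable X]setTI; exact: measurable_rV_coord.
rewrite big_ord_recl -(ih (fun i => A (lift ord0 i)))//= /lebesgue_step.
rewrite -product_measure1E//; congr (_ _).
apply/seteqP; split => -[x v] /=.
- move=> Av; split; first by have := Av 0%R; rewrite mxE unlift_none.
  by move=> i; have := Av (lift ord0 i); rewrite mxE liftK.
- move=> [Ax Bv] i; rewrite mxE; case: unliftP => [j|] -> //=; exact: Bv.
Qed.

End lebesgue_rV_box.

(** Surface measure of the unit sphere S^(m-1) of R^m, as determined by polar
    coordinates: sigma(A) = m * |{t theta : 0 < t <= 1, theta in A}|. *)

Section sphere.
Context {R : realType}.
Local Open Scope ereal_scope.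

Definition unit_sphere m : set 'rV[R]_m := [set x | enorm x = 1%R].

Definition surface_measure m (A : set 'rV[R]_m) : \bar R :=
  m%:R%:E *
  lebesgue_rV m [set t *: theta | t in `]0%R, 1%R] & theta in A]%R.

(* The volume of the n-dimensional sphere S^n, which lies in R^(n+1). *)
Definition sphere_volume n : \bar R := surface_measure (@unit_sphere n.+1).

End sphere.

Section omega.
Context {R : realType} {n : nat}.
Implicit Types (x xi : 'rV[R]_n) (D : set 'rV[R]_n) (z : R).
Local Open Scope ereal_scope.

Definition collision_integral z x xi : \bar R :=
  \int[lebesgue_measure]_(s in `[z, +oo[) \int[lebesgue_rV n]_xis
    (expR (- enorm (x + s *: xi - s *: xis) ^+ 2 - enorm xis ^+ 2)
     * enorm (xi - xis))%:E.

Definition Omega_dom D z : \bar R :=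
  ereal_sup [set (\1_D x)%:E * collision_integral z x xi
            | x in [set: 'rV[R]_n] & xi in [set: 'rV[R]_n]].

End omega.

Definition Omega (R : realType) (n : nat) : \bar R :=
  ereal_sup [set collision_integral 0 x xi
            | x in [set: 'rV[R]_n] & xi in [set: 'rV[R]_n]].

(* Main.v *)
Require Import Defs.
From mathcomp Require Import all_boot all_order all_algebra.
From mathcomp Require Import all_classical all_reals all_analysis.
From mathcomp Require Import measurable_realfun ring lra.

(** Put w = xi - xis.  By Cauchy-Schwarz, |x + s w|^2 >= (s |w| + b)^2 for
    some b >= - |x|, so the change of variable s |w| + b bounds
    int_z^oo e^(-|x + s w|^2) |w| ds by the Gaussian tail from z |w| - |x|.
    After Tonelli this gives (ii) at once.  For (i), the xis with
    |w| >= 1 / ln z contribute at most the first term; the others fill a ball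
    of radius 1 / ln z, and |B^n| <= (n+1) |B^(n+1)| is the volume of S^n. *)

Import Order.TTheory GRing.Theory Num.Theory.
Import numFieldNormedType.Exports.

Local Open Scope classical_set_scope.
Local Open Scope ring_scope.

(** * Euclidean norm and Cauchy-Schwarz *)

Section euclidean.
Set Implicit Arguments.
Context {R : realType} {n : nat}.
Implicit Types x w : 'rV[R]_n.

Lemma enorm_ge0 x : 0 <= enorm x.
Proof. exact: sqrtr_ge0. Qed.

Lemma sqr_enorm x : enorm x ^+ 2 = \sum_(i < n) x 0 i ^+ 2.
Proof. by rewrite sqr_sqrtr// sumr_ge0// => i _; exact: sqr_ge0. Qed.

Lemma enormN x : enorm (- x) = enorm x.
Proof. by congr Num.sqrt; apply: eq_bigr => i _; rewrite mxE sqrrN. Qed.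

Lemma enormZ (a : R) x : enorm (a *: x) = `|a| * enorm x.
Proof.
rewrite /enorm -sqrtr_sqr -sqrtrM ?sqr_ge0//; congr Num.sqrt.
by rewrite mulr_sumr; apply: eq_bigr => i _; rewrite mxE exprMn.
Qed.

(** With [p] the inner product, the squares of |w|^2 x_i - p w_i add up to |w|^2 (|x|^2 |w|^2 -
    p^2). This sum is nonnegative, and |w|^2 cancels unless it is 0, in which case every coordinate
    of [w] vanishes. *)
Lemma cauchy_schwarz_sqr x w :
  (\sum_(i < n) x 0 i * w 0 i) ^+ 2 <= enorm x ^+ 2 * enorm w ^+ 2.
Proof.
set p := \sum_(i < n) _.
have [w0|w_gt0] := eqVneq (enorm w ^+ 2) 0.
  suff -> : p = 0 by rewrite w0 expr0n mulr0.
  rewrite /p big1// => i _; have /eqP := w0.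
  rewrite sqr_enorm psumr_eq0; last by move=> j _; exact: sqr_ge0.
  move=> /allP/(_ i); rewrite mem_index_enum sqrf_eq0 => /(_ isT)/eqP ->.
  by rewrite mulr0.
have := sumr_ge0 (index_enum 'I_n)
  (fun i (_ : true) => sqr_ge0 (enorm w ^+ 2 * x 0 i - p * w 0 i)).
have -> : \sum_(i < n) (enorm w ^+ 2 * x 0 i - p * w 0 i) ^+ 2 =
    enorm w ^+ 2 * (enorm x ^+ 2 * enorm w ^+ 2 - p ^+ 2).
  transitivity (\sum_(i < n) (enorm w ^+ 2) ^+ 2 * x 0 i ^+ 2
      - \sum_(i < n) 2 * enorm w ^+ 2 * p * (x 0 i * w 0 i)
      + \sum_(i < n) p ^+ 2 * w 0 i ^+ 2).
    rewrite -sumrB -big_split /=; apply: eq_bigr => i _; ring.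
  rewrite -!mulr_sumr -/p -!sqr_enorm; ring.
by rewrite pmulr_rge0 ?subr_ge0// lt_neqAle eq_sym w_gt0 sqr_ge0.
Qed.

(** Take for [b] the signed length of the projection of [x] onto the direction of [w]. The two
    squares then differ by |x|^2 - b^2, which does not depend on [s] and is nonnegative by
    Cauchy-Schwarz. *)
Lemma enorm_line x w : enorm w != 0 -> exists2 b : R, - enorm x <= b &
  forall s, (enorm w * s + b) ^+ 2 <= enorm (x + s *: w) ^+ 2.
Proof.
move=> w0; pose p := \sum_(i < n) x 0 i * w 0 i.
have pb : (p / enorm w) ^+ 2 <= enorm x ^+ 2.
  rewrite expr_div_n ler_pdivrMr; first exact: cauchy_schwarz_sqr.
  by rewrite exprn_even_gt0.
exists (p / enorm w).
  by have := enorm_ge0 x; nra.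
move=> s.
have -> : enorm (x + s *: w) ^+ 2 = enorm x ^+ 2 + 2 * s * p + s ^+ 2 * enorm w ^+ 2.
  rewrite !sqr_enorm /p !mulr_sumr -!big_split/=.
  by apply: eq_bigr => i _; rewrite !mxE; ring.
have -> : (enorm w * s + p / enorm w) ^+ 2 =
    (p / enorm w) ^+ 2 + 2 * s * p + s ^+ 2 * enorm w ^+ 2.
  by field.
by rewrite !lerD2r.
Qed.

End euclidean.

(** * Measurability of the Euclidean norm *)

Section measurability.
Set Implicit Arguments.
Context {R : realType} d (T : measurableType d).

Lemma measurable_enorm n (f : T -> 'rV[R]_n) :
  (forall i, measurable_fun setT (fun t => f t 0 i : R)) ->
  measurable_fun setT (fun t => enorm (f t)).
Proof.
move=> mf; rewrite (_ : (fun t => _) =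
    (fun y : R => Num.sqrt y) \o (fun t => \sum_(i < n) f t 0 i ^+ 2))//.
apply: measurableT_comp.
  by apply: continuous_measurable_fun; exact: sqrt_continuous.
by apply: measurable_sum => i; exact: measurable_funX.
Qed.

(** The radius [g] varies with the point so that cones are covered as well as balls. *)
Lemma measurable_enorm_lt n (f : T -> 'rV[R]_n) (g : T -> R) :
  (forall i, measurable_fun setT (fun t => f t 0 i : R)) ->
  measurable_fun setT g -> measurable [set t | enorm (f t) < g t].
Proof.
move=> mf mg; rewrite -[X in measurable X]setTI.
have := measurable_fun_ltr (measurable_enorm _ mf) mg measurableT
  (I : measurable [set true]).
by apply.
Qed.

End measurability.

(** * Affine substitution and Gaussian integrals along a line *)

Section gaussian.
Set Implicit Arguments.
Context {R : realType}.
Local Open Scope ereal_scope.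
Local Notation mu := (@lebesgue_measure R).

(** The pushforward of Lebesgue measure under x -> a x + b, scaled by [a], gives each interval []u,
    v]] its length, hence is Lebesgue measure by uniqueness. *)
Lemma ge0_integral_affine (a b : R) (D : set R) (f : R -> \bar R) :
    (0 < a)%R -> measurable D -> measurable_fun D f -> (forall x, 0 <= f x) ->
  \int[mu]_(x in D) f x =
  a%:E * \int[mu]_(x in (fun x => a * x + b)%R @^-1` D) f (a * x + b)%R.
Proof.
move=> a0 mD mf f0.
pose phi (x : measurableTypeR R) : measurableTypeR R := (a * x + b)%R.
have mphi : measurable_fun setT phi.
  by apply: measurable_funD => //; exact: measurable_funM.
rewrite -[X in a%:E * X](@ge0_integral_pushforward _ _ _ _ _ _ mphi mu D f)//.
(* Reading [a] as a nonnegative number lets [mscale] absorb it into the measure, so that only two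
   measures remain to be compared. *)
rewrite -[a%:E]/((NngNum (ltW a0))%:num%:E) -ge0_integral_mscale//.
apply: eq_measure_integral => A mA _.
apply: lebesgue_measure_unique => //= _ [[u v]] _ <-.
rewrite /mscale /= -[pushforward _ _ _]/(mu (phi @^-1` `]u, v])).
have -> : phi @^-1` `]u, v] =
    `]((u - b) / a)%R, ((v - b) / a)%R]%classic :> set R.
  apply/seteqP; split => x; rewrite /phi/= !in_itv/=;
    by rewrite ltr_pdivrMr// ler_pdivlMr// ltrBlDr lerBrDr mulrC.
rewrite !lebesgue_measure_itv/= !lte_fin ltr_pM2r ?invr_gt0// ltrD2r.
case: ifPn => _; last by rewrite mule0.
rewrite -!EFinB -EFinM; congr EFin; field; exact: lt0r_neq0.
Qed.

Lemma integral_gauss_ray (a : R) :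
  \int[mu]_(s in `[a, +oo[) (expR (- s ^+ 2))%:E <= (Num.sqrt pi)%:E.
Proof.
rewrite -integralT_gauss; apply: ge0_subset_integral => //.
by apply/measurable_EFinP; exact: measurable_gauss_fun.
Qed.

(** The factor |w| of the integrand is the Jacobian of s -> |w| s + b, so [w] survives only in the
    endpoint of the tail. If |w| = 0, the integrand vanishes. *)
Lemma integral_gauss_line n (x w : 'rV[R]_n) (z : R) :
  \int[mu]_(s in `[z, +oo[) (expR (- enorm (x + s *: w) ^+ 2) * enorm w)%:E <=
  \int[mu]_(s in `[(enorm w * z - enorm x)%R, +oo[) (expR (- s ^+ 2))%:E.
Proof.
have mg (D : set R) : measurable_fun D (fun s : R => (expR (- s ^+ 2))%:E).
  by apply/measurable_EFinP/measurable_funTS; exact: measurable_gauss_fun.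
have [w0|w0] := eqVneq (enorm w) 0%R.
  rewrite integral0_eq; last by move=> s _; rewrite w0 mulr0.
  by apply: integral_ge0 => s _; rewrite lee_fin expR_ge0.
have w_gt0 : (0 < enorm w)%R by rewrite lt_neqAle eq_sym w0 enorm_ge0.
have [b xb wb] := enorm_line x _ w0.
(* Since [- enorm x <= b], the ray reached by the substitution lies inside the ray of the
   conclusion. *)
apply: (@le_trans _ _ (\int[mu]_(s in `[(enorm w * z + b)%R, +oo[)
    (expR (- s ^+ 2))%:E)); last first.
  apply: ge0_subset_integral => //.
  - exact: mg.
  - by apply: subset_itvr; rewrite bnd_simp lerD2l.
rewrite [X in _ <= X](@ge0_integral_affine (enorm w) b)//.
have -> : (fun s => enorm w * s + b)%R @^-1` `[(enorm w * z + b)%R, +oo[ = `[z, +oo[%classic.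
  by apply/seteqP; split => s; rewrite /= !in_itv/= !andbT lerD2r ler_pM2l.
have maff : measurable_fun setT (fun s : R => (enorm w * s + b)%R).
  by apply: measurable_funD => //; exact: measurable_funM.
rewrite -ge0_integralZl//; last 2 first.
- apply/measurable_EFinP/measurable_funTS.
  exact: (measurableT_comp (@measurable_gauss_fun R) maff).
- by rewrite lee_fin enorm_ge0.
apply: ge0_le_integral => //.
- by move=> s _; rewrite lee_fin mulr_ge0 ?expR_ge0 ?enorm_ge0.
- apply/measurable_EFinP/measurable_funTS/measurable_funM => //.
  apply: measurableT_comp; first exact: measurable_expR.
  apply: measurableT_comp => //; apply: measurable_funX.
  apply: measurable_enorm => i.
  under eq_fun do rewrite !mxE.
  by apply: measurable_funD => //; exact: measurable_funM.
- apply/measurable_funeM/measurable_EFinP/measurable_funTS.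
  exact: (measurableT_comp (@measurable_gauss_fun R) maff).
- move=> s _; rewrite -EFinM lee_fin mulrC ler_pM2l// ler_expR lerN2.
  exact: wb.
Qed.

End gaussian.

(** * Slicing and scaling of Lebesgue measure on R^n *)

Section lebesgue_rV_theory.
Set Implicit Arguments.
Context {R : realType}.
Local Open Scope ereal_scope.
Local Notation mu := (@lebesgue_measure R).

(** Cavalieri's principle along the first coordinate, for the scaling law and the volume of the
    cone. *)
Lemma lebesgue_rV_cons n (A : set 'rV[R]_n.+1) :
  lebesgue_rV n.+1 A = \int[mu]_x lebesgue_rV n [set v | A (rV_cons (x, v))].
Proof.
apply: eq_integral => x _ /=; congr (lebesgue_rV n _).
by rewrite xsectionE.
Qed.

Lemma measurable_rV_preimage d (T : measurableType d) n (f : T -> 'rV[R]_n)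
    (A : set 'rV[R]_n) :
  (forall i, measurable_fun setT (fun t => f t 0%R i : R)) ->
  measurable A -> measurable (f @^-1` A).
Proof.
by move=> mf mA; rewrite -[X in measurable X]setTI; apply: measurable_fun_rV.
Qed.

Lemma measurable_lebesgue_rV_slice n (A : set 'rV[R]_n.+1) : measurable A ->
  measurable_fun setT
    (fun x : measurableTypeR R => lebesgue_rV n [set v | A (rV_cons (x, v))]).
Proof.
move=> mA; rewrite (_ : (fun x => _) =
    lebesgue_rV n \o xsection (@rV_cons R n @^-1` A)); last first.
  by apply/funext => x /=; rewrite xsectionE.
apply: measurable_fun_xsection; rewrite -[X in measurable X]setTI.
exact: measurable_rV_cons.
Qed.

Lemma ge0_integral_rV_cons n (f : 'rV[R]_n.+1 -> \bar R) :
    measurable_fun setT f -> (forall v, 0 <= f v) ->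
  \int[lebesgue_rV n.+1]_v f v =
  \int[mu]_x \int[lebesgue_rV n]_v f (rV_cons (x, v)).
Proof.
move=> mf f0.
have mcons := @measurable_rV_cons R n.
transitivity (\int[(mu \x lebesgue_rV n)%E]_p (f \o @rV_cons R n) p).
  have := @ge0_integral_pushforward _ _ _ _ _ _ mcons (mu \x lebesgue_rV n)%E
    setT f measurableT mf (fun v _ => f0 v).
  by rewrite preimage_setT => <-; apply: eq_measure_integral.
rewrite fubini_tonelli1//; last by move=> p; exact: f0.
exact: measurableT_comp.
Qed.

(** Induction on the dimension: substituting in the first coordinate yields one factor [rho], and
    the slices, themselves affine preimages, yield the other [n]. *)
Lemma lebesgue_rV_affine n (rho : R) (c : 'rV[R]_n) (A : set 'rV[R]_n) :
    (0 < rho)%R -> measurable A ->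
  lebesgue_rV n A =
  (rho ^+ n)%:E * lebesgue_rV n ((fun v => rho *: v + c)%R @^-1` A).
Proof.
move=> rho0; elim: n c A => [|n ih] c A mA.
  (* R^0 has a single point, so the affine map is the identity there. *)
  rewrite expr0 mul1e; congr (lebesgue_rV 0 _).
  apply/seteqP; split => v; rewrite /preimage/= => Av;
    by rewrite [X in A X](_ : _ = v)// || rewrite (_ : v = rho *: v + c)%R//;
    apply/rowP => -[].
rewrite lebesgue_rV_cons (@ge0_integral_affine _ rho (c 0 0)%R)//; last first.
  exact: measurable_lebesgue_rV_slice.
rewrite lebesgue_rV_cons preimage_setT exprS EFinM -muleA; congr (_ * _).
pose c' := (\row_j c 0 (lift 0 j))%R.
rewrite -ge0_integralZl//; last 2 first.
- apply: (measurable_lebesgue_rV_slice (A := (fun v => rho *: v + c)%R @^-1` A)).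
  apply: measurable_rV_preimage => // i.
  under eq_fun do rewrite !mxE.
  apply: measurable_funD => //; apply: measurable_funM => //.
  exact: measurable_rV_coord.
- by rewrite lee_fin exprn_ge0// ltW.
apply: eq_integral => x _.
(* The slice of the preimage at [x] is the preimage, under v -> rho v + c', of the slice of [A] at
   rho x + c_0. *)
rewrite (ih c'); last first.
  apply: measurable_rV_preimage => // i.
  under eq_fun do rewrite mxE.
  by case: unliftP => [j|] _ /=; [exact: measurable_rV_coord|exact: measurable_cst].
congr (_ * lebesgue_rV n _); apply/seteqP; split => v; rewrite /preimage/=.
- rewrite [X in A X -> _](_ : _ = rho *: rV_cons (x, v) + c)%R//.
  by apply/rowP => i; rewrite !mxE; case: unliftP => [j|] ->/=; rewrite ?mxE.
- rewrite [X in _ -> A X](_ : _ = rho *: rV_cons (x, v) + c)%R//.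
  by apply/rowP => i; rewrite !mxE; case: unliftP => [j|] ->/=; rewrite ?mxE.
Qed.

(** * The Gaussian integral on R^n *)

Lemma sqr_enorm_cons n (x : R) (v : 'rV[R]_n) :
  (enorm (rV_cons (x, v)) ^+ 2 = x ^+ 2 + enorm v ^+ 2)%R.
Proof.
rewrite !sqr_enorm big_ord_recl mxE unlift_none/=; congr (_ + _)%R.
by apply: eq_bigr => i _; rewrite mxE liftK.
Qed.

Lemma measurable_gauss_rV n :
  measurable_fun setT (fun v : 'rV[R]_n => (@expR R (- enorm v ^+ 2))%:E).
Proof.
apply/measurable_EFinP; apply: measurableT_comp; first exact: measurable_expR.
apply: measurableT_comp => //; apply: measurable_funX.
by apply: measurable_enorm => i; exact: measurable_rV_coord.
Qed.

(** The Gaussian factors over the coordinates, each contributing sqrt(pi). In dimension 0 the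
    measure is the Dirac mass at 0 and the integral is 1. *)
Lemma integral_gauss_rV n :
  \int[lebesgue_rV n]_v (@expR R (- enorm v ^+ 2))%:E = (Num.sqrt pi ^+ n)%:E.
Proof.
elim: n => [|n ih].
  rewrite (@integral_dirac _ 'rV[R]_0 _ R _ measurableT _ (@measurable_gauss_rV 0))//=.
  rewrite diracE mem_set// mul1e sqr_enorm big_ord0.
  by rewrite oppr0 expR0.
rewrite ge0_integral_rV_cons; [|exact: measurable_gauss_rV|by []].
rewrite exprSr EFinM -integralT_gauss -ge0_integralZl//; last 2 first.
- by apply/measurable_EFinP; exact: measurable_gauss_fun.
- by move=> x _; rewrite lee_fin gauss_fun_ge0.
apply: eq_integral => x _; rewrite -ih muleC -ge0_integralZl//; last 2 first.
- exact: measurable_gauss_rV.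
- by rewrite lee_fin expR_ge0.
by apply: eq_integral => v _; rewrite sqr_enorm_cons opprD expRD EFinM.
Qed.

(** * Balls and the volume of the unit sphere *)

Lemma measurable_eball n (c : 'rV[R]_n) (rho : R) : measurable (eball c rho).
Proof.
apply: measurable_enorm_lt => // i.
under eq_fun do rewrite !mxE.
by apply: measurable_funB => //; exact: measurable_rV_coord.
Qed.

Lemma lebesgue_rV_eball n (c : 'rV[R]_n) (rho : R) : (0 < rho)%R ->
  lebesgue_rV n (eball c rho) = (rho ^+ n)%:E * lebesgue_rV n (eball 0%R 1%R).
Proof.
move=> rho0; rewrite (@lebesgue_rV_affine n rho c)//; last exact: measurable_eball.
congr (_ * lebesgue_rV n _); apply/seteqP; split => v; rewrite /eball/preimage/=;
  rewrite opprD addrCA subrr addr0 sub0r !enormN enormZ gtr0_norm//;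
  by rewrite -ltr_pdivlMl// mulVf// gt_eqF.
Qed.

(** Polar decomposition v = |v| (v / |v|). It turns the set inside [surface_measure] into a
    punctured ball, visibly measurable; the origin is missing because 0 < t. *)
Lemma unit_sphere_radial n :
  [set t *: theta | t in `]0%R, 1%R] & theta in @unit_sphere R n]%R =
  [set v | 0 < enorm v <= 1]%R.
Proof.
apply/seteqP; split => v /=.
  move=> [t]; rewrite in_itv/= => /andP[t0 t1] [theta theta1 <-].
  by rewrite enormZ theta1 mulr1 gtr0_norm// t0.
move=> /andP[v0 v1]; exists (enorm v); first by rewrite in_itv/= v0.
exists ((enorm v)^-1 *: v)%R.
  by rewrite /unit_sphere/= enormZ gtr0_norm ?invr_gt0// mulVf// gt_eqF.
by rewrite scalerA divff ?scale1r// gt_eqF.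
Qed.

Lemma measurable_punctured_ball n :
  measurable [set v : 'rV[R]_n | 0 < enorm v <= 1]%R.
Proof.
have me : measurable_fun setT (@enorm R n).
  by apply: measurable_enorm => i; exact: measurable_rV_coord.
rewrite (_ : [set v | _] = setT `&` @enorm R n @^-1` `]0%R, 1%R]).
  exact: me.
by rewrite setTI; apply/seteqP; split => v; rewrite /= in_itv.
Qed.

(** Each |v_i| is at most |v|, so the punctured unit ball lies in the cube [[-1, 1]]^(n+1), whose
    volume is finite. *)
Lemma sphere_volume_fin n : @sphere_volume R n < +oo.
Proof.
rewrite /sphere_volume /surface_measure unit_sphere_radial.
apply: lte_mul_pinfty => //.
apply: (@le_lt_trans _ _ (lebesgue_rV n.+1
    [set v : 'rV[R]_n.+1 | forall i, `[(-1)%R, 1%R]%classic (v 0%R i)])).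
  apply: le_measure; rewrite ?inE.
  - exact: measurable_punctured_ball.
  - rewrite (_ : [set v | _] = \bigcap_(i in [set: 'I_n.+1])
        (@rV_coord R n.+1 i @^-1` `[(-1)%R, 1%R])); last first.
      by apply/seteqP; split => [v Bv i _|v Bv i]; exact: Bv.
    apply: fin_bigcap_measurable => // i _.
    by rewrite -[X in measurable X]setTI; exact: measurable_rV_coord.
  - move=> v /= /andP[v0 v1] i; rewrite in_itv/= -ler_norml -sqrtr_sqr.
    apply: le_trans v1; rewrite ler_wsqrtr// (bigD1 i)//= lerDl.
    by rewrite sumr_ge0// => j _; exact: sqr_ge0.
rewrite (lebesgue_rV_box (A := fun=> `[(-1)%R, 1%R]%classic))//.
rewrite lebesgue_measure_itv/= lte_fin ifT; last by lra.
by rewrite -EFinB prodEFin ltry.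
Qed.

Lemma integral_onemXn n :
  \int[mu]_(x in `]0%R, 1%R[) ((1 - x) ^+ n)%:E = (n.+1%:R^-1)%:E.
Proof.
have mf : measurable_fun setT (fun x : R => ((1 - x) ^+ n)%:E).
  by apply/measurable_EFinP/measurable_funX/measurable_funB.
(* Adding the two endpoints, of measure zero, gives the closed interval [[0, 1]]. *)
rewrite -(@integral_itv_bndoo _ _ _ _ true false); last exact: measurable_funTS.
rewrite -(Rintegral_onemXn n) /Rintegral fineK//.
apply: integrable_fin_num => //.
apply: eq_integrable (integrable_XMonemX 0 n) => // x _ /=.
by rewrite XMonemX0n.
Qed.

(* The cone of height 1 over the unit ball of R^n sits in the unit ball of
   R^(n+1) and has volume |B^n| / (n+1). *)
Lemma lebesgue_rV_eball_le_sphere_volume n :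
  lebesgue_rV n (eball (0%R : 'rV[R]_n) 1%R) <= @sphere_volume R n.
Proof.
rewrite /sphere_volume /surface_measure unit_sphere_radial.
(* The axis of the cone is the first coordinate; keeping it positive excludes the origin, as the
   punctured ball requires. *)
pose C := (@rV_coord R n.+1 0%R @^-1` `]0%R, 1%R[) `&`
  [set v : 'rV[R]_n.+1 | enorm (\row_j v 0 (lift 0 j)) < 1 - v 0 0]%R.
have mC : measurable C.
  apply: measurableI.
    by rewrite -[X in measurable X]setTI; exact: measurable_rV_coord.
  apply: measurable_enorm_lt => [i|].
    under eq_fun do rewrite mxE.
    exact: measurable_rV_coord.
  apply: measurable_funB => //; exact: measurable_rV_coord.
apply: (@le_trans _ _ (n.+1%:R%:E * lebesgue_rV n.+1 C)); last first.
  apply: lee_wpmul2l => //; apply: le_measure; rewrite ?inE//.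
    exact: measurable_punctured_ball.
  move=> v []; rewrite /= /rV_coord in_itv/= => /andP[v0 v1] vC.
  have vE : (enorm v ^+ 2 = v 0 0 ^+ 2 + enorm (\row_j v 0 (lift 0 j)) ^+ 2)%R.
    rewrite -sqr_enorm_cons; congr (enorm _ ^+ 2)%R.
    by apply/rowP => i; rewrite !mxE; case: unliftP => [j|] ->/=; rewrite ?mxE.
  (* With t = v_0, |v|^2 < t^2 + (1 - t)^2 = 1 - 2 t (1 - t) < 1. *)
  have := enorm_ge0 v; have := enorm_ge0 (\row_j v 0%R (lift 0%R j)).
  by move: vE vC; set a := enorm v; set b := enorm _ => vE vC b0 a0; nra.
rewrite lebesgue_rV_cons.
(* The slice of [C] at height [x] is the ball of radius 1 - x for [x] in []0, 1[], and is empty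
   otherwise. *)
have -> : \int[mu]_x lebesgue_rV n [set v | C (rV_cons (x, v))] =
    \int[mu]_(x in `]0%R, 1%R[) (((1 - x) ^+ n)%:E * lebesgue_rV n (eball 0%R 1%R)).
  rewrite [RHS]integral_mkcond; apply: eq_integral => x _.
  rewrite patchE; case: ifPn => [/set_mem|/negP x01].
    rewrite /= in_itv/= => /andP[x0 x1].
    rewrite -(@lebesgue_rV_eball _ 0%R (1 - x)%R) ?subr_gt0//.
    congr (lebesgue_rV n _); apply/seteqP.
    have tailE v : (\row_j rV_cons (x, v) 0 (lift 0 j) = v)%R.
      by apply/rowP => j; rewrite !mxE liftK.
    split => v; rewrite /C/eball/= tailE /rV_coord mxE unlift_none/= sub0r enormN.
      by case.
    by rewrite in_itv/= x0 x1.
  rewrite [X in lebesgue_rV n X](_ : _ = set0) ?measure0//.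
  apply/seteqP; split => // v [] /=; rewrite /rV_coord mxE unlift_none/=.
  by move=> /mem_set.
rewrite ge0_integralZr//=; last 2 first.
- apply/measurable_EFinP; apply: measurable_funTS.
  by apply/measurable_funX/measurable_funB.
- move=> x; rewrite /= in_itv/= => /andP[_ x1].
  by rewrite lee_fin exprn_ge0// subr_ge0 ltW.
by rewrite integral_onemXn muleA -EFinM divff// mul1e.
Qed.

End lebesgue_rV_theory.

(** * Bounds on the collision integral *)

Section collision.
Set Implicit Arguments.
Context {R : realType} {n : nat}.
Implicit Types (x xi v : 'rV[R]_n) (z a r rho : R).
Local Open Scope ereal_scope.
Local Notation mu := (@lebesgue_measure R).

Definition gauss_tail a : \bar R := \int[mu]_(s in `[a, +oo[) (expR (- s ^+ 2))%:E.

Lemma gauss_tail_ge0 a : 0 <= gauss_tail a.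
Proof. by apply: integral_ge0 => s _; rewrite lee_fin expR_ge0. Qed.

Lemma gauss_tail_fin a : gauss_tail a < +oo.
Proof. by rewrite (le_lt_trans (integral_gauss_ray a))// ltry. Qed.

Lemma gauss_tail_anti a b : (a <= b)%R -> gauss_tail b <= gauss_tail a.
Proof.
move=> ab; apply: ge0_subset_integral => //.
- by apply/measurable_EFinP/measurable_funTS; exact: measurable_gauss_fun.
- by apply: subset_itvr; rewrite bnd_simp.
Qed.

(** The condition z <= s is encoded as an indicator, so that Tonelli applies on the whole product
    space. *)
Definition collision_kernel z x xi (p : measurableTypeR R * 'rV[R]_n) : R :=
  expR (- enorm (x + p.1 *: (xi - p.2)) ^+ 2 - enorm p.2 ^+ 2)
  * enorm (xi - p.2) * \1_(`[z, +oo[%classic : set (measurableTypeR R)) p.1.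

Lemma collision_kernel_ge0 z x xi p : (0 <= collision_kernel z x xi p)%R.
Proof. by rewrite !mulr_ge0 ?expR_ge0 ?enorm_ge0. Qed.

Lemma measurable_collision_kernel z x xi :
  measurable_fun setT (EFin \o collision_kernel z x xi).
Proof.
have mc i : measurable_fun setT
    (fun p : measurableTypeR R * 'rV[R]_n => p.2 0%R i : R).
  exact: (measurableT_comp (measurable_rV_coord i) measurable_snd).
apply/measurable_EFinP; apply: measurable_funM; last first.
  exact: (measurableT_comp (measurable_indic _) measurable_fst).
apply: measurable_funM; last first.
  apply: measurable_enorm => i; under eq_fun do rewrite !mxE.
  exact: measurable_funB.
apply: measurableT_comp; first exact: measurable_expR.
apply: measurable_funB; last by apply: measurable_funX; exact: measurable_enorm.
apply: measurableT_comp => //; apply: measurable_funX.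
apply: measurable_enorm => i; under eq_fun do rewrite !mxE.
apply: measurable_funD => //; apply: measurable_funM; first exact: measurable_fst.
exact: measurable_funB.
Qed.

Lemma collision_integral_kernel z x xi : collision_integral z x xi =
  \int[lebesgue_rV n]_v \int[mu]_s (collision_kernel z x xi (s, v))%:E.
Proof.
have f0 p : 0 <= (EFin \o collision_kernel z x xi) p.
  by rewrite lee_fin collision_kernel_ge0.
have := @fubini_tonelli _ _ _ _ R mu (lebesgue_rV n) _
  (measurable_collision_kernel z x xi) f0.
rewrite /fubini_F /fubini_G /= => <-.
rewrite /collision_integral integral_mkcond; apply: eq_integral => s _.
rewrite patchE /collision_kernel; case: ifPn => sz.
  by apply: eq_integral => v _; rewrite indicE sz mulr1 scalerBr addrA.
by rewrite integral0_eq// => v _; rewrite indicE (negbTE sz) mulr0.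
Qed.

Lemma measurable_integral_collision_kernel z x xi : measurable_fun setT
  (fun v => \int[mu]_s (collision_kernel z x xi (s, v))%:E).
Proof.
have := @measurable_fun_fubini_tonelli_G _ _ _ _ R mu _
  (measurable_collision_kernel z x xi); apply => p.
by rewrite lee_fin collision_kernel_ge0.
Qed.

(** The weight e^(-|v|^2) does not depend on [s] and comes out of the integral; what remains is the
    line integral with w = xi - v. *)
Lemma integral_collision_kernel_le z x xi v :
  \int[mu]_s (collision_kernel z x xi (s, v))%:E <=
  (expR (- enorm v ^+ 2))%:E * gauss_tail (enorm (xi - v) * z - enorm x).
Proof.
have -> : \int[mu]_s (collision_kernel z x xi (s, v))%:E =
    (expR (- enorm v ^+ 2))%:E * \int[mu]_(s in `[z, +oo[)
      (expR (- enorm (x + s *: (xi - v)) ^+ 2) * enorm (xi - v))%:E.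
  rewrite -ge0_integralZl//; last 2 first.
  - apply/measurable_EFinP/measurable_funTS; apply: measurable_funM => //.
    apply: measurableT_comp; first exact: measurable_expR.
    apply: measurableT_comp => //; apply: measurable_funX.
    apply: measurable_enorm => i; under eq_fun do rewrite mxE [X in (_ + X)%R]mxE.
    by apply: measurable_funD => //; exact: measurable_funM.
  - by move=> s _; rewrite lee_fin mulr_ge0 ?expR_ge0 ?enorm_ge0.
  rewrite [RHS]integral_mkcond; apply: eq_integral => s _.
  rewrite patchE /collision_kernel indicE/=; case: ifPn => sz; last by rewrite mulr0.
  by rewrite mulr1 -EFinM addrC expRD mulrA.
by apply: lee_wpmul2l => //; exact: integral_gauss_line.
Qed.

(** Wherever the tail starts, it is at most the full Gaussian integral sqrt(pi); the weight in [v]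
    gives the other [n] factors. The bound is thus uniform in [z], [x] and [xi]. *)
Lemma collision_integral_le z x xi :
  collision_integral z x xi <= (Num.sqrt pi ^+ n.+1)%:E.
Proof.
rewrite collision_integral_kernel exprSr EFinM -integral_gauss_rV.
rewrite -ge0_integralZr//; last exact: measurable_gauss_rV.
apply: ge0_le_integral => //.
- by move=> v _; apply: integral_ge0 => s _; rewrite lee_fin collision_kernel_ge0.
- exact: measurable_integral_collision_kernel.
- apply: emeasurable_funM => //; exact: measurable_gauss_rV.
move=> v _; apply: le_trans (integral_collision_kernel_le _ _ _ _) _.
by apply: lee_wpmul2l => //; exact: integral_gauss_ray.
Qed.

(** The cutoff |xi - v| = [rho] is left free: a large [rho] shortens the far tail but enlarges the
    near ball. *)
Lemma collision_integral_le_split z x xi r rho :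
  (0 <= z)%R -> (0 < rho)%R -> (enorm x <= r)%R ->
  collision_integral z x xi <=
  (Num.sqrt pi ^+ n)%:E * gauss_tail (z * rho - r)
  + sphere_volume n * (rho ^+ n)%:E * gauss_tail (- r).
Proof.
move=> z0 rho0 xr; rewrite collision_integral_kernel -integral_gauss_rV.
apply: (@le_trans _ _ (\int[lebesgue_rV n]_v
    ((expR (- enorm v ^+ 2))%:E * gauss_tail (z * rho - r)
     + (\1_(eball xi rho) v)%:E * gauss_tail (- r)))).
  apply: ge0_le_integral => //.
  - by move=> v _; apply: integral_ge0 => s _; rewrite lee_fin collision_kernel_ge0.
  - exact: measurable_integral_collision_kernel.
  - apply: emeasurable_funD; apply: emeasurable_funM => //.
      exact: measurable_gauss_rV.
    by apply/measurable_EFinP/measurable_indic; exact: measurable_eball.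
  move=> v _; apply: le_trans (integral_collision_kernel_le _ _ _ _) _.
  have e1 : (expR (- enorm v ^+ 2) <= 1)%R by rewrite expR_le1 oppr_le0 sqr_ge0.
  rewrite indicE; case: (boolP (v \in eball xi rho)) => /= [|vxi].
    (* Near [xi]: the weight is at most 1, and the tail starts at or above [- r] because
       [0 <= z]. *)
    move=> _; rewrite mul1e -[leLHS]add0e; apply: leeD.
      by rewrite mule_ge0// gauss_tail_ge0.
    apply: (@le_trans _ _ (1 * gauss_tail (- r))); last by rewrite mul1e.
    apply: lee_pmul => //; first exact: gauss_tail_ge0.
    apply: gauss_tail_anti.
    have : (0 <= enorm (xi - v) * z)%R by rewrite mulr_ge0// enorm_ge0.
    lra.
  (* Away from [xi]: the weight is kept, and the tail starts at or above [z * rho - r]. *)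
  rewrite mul0e adde0; apply: lee_wpmul2l => //; apply: gauss_tail_anti.
  have : (rho <= enorm (xi - v))%R.
    by rewrite leNgt; apply: contra vxi => vxi; rewrite inE.
  move=> vrho; have : (rho * z <= enorm (xi - v) * z)%R by rewrite ler_wpM2r.
  lra.
rewrite ge0_integralD//; last 4 first.
- by move=> v _; rewrite mule_ge0// gauss_tail_ge0.
- apply: emeasurable_funM => //; exact: measurable_gauss_rV.
- by move=> v _; rewrite mule_ge0// ?lee_fin// gauss_tail_ge0.
- apply: emeasurable_funM => //.
  by apply/measurable_EFinP/measurable_indic; exact: measurable_eball.
rewrite ge0_integralZr//; last 2 first.
- exact: measurable_gauss_rV.
- exact: gauss_tail_ge0.
rewrite ge0_integralZr//; last 2 first.
- by apply/measurable_EFinP/measurable_indic; exact: measurable_eball.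
- exact: gauss_tail_ge0.
apply: leeD => //; apply: lee_wpmul2r; first exact: gauss_tail_ge0.
rewrite integral_indic//; last exact: measurable_eball.
rewrite setIT [leLHS](lebesgue_rV_eball xi _ rho0) muleC; apply: lee_wpmul2r.
  by rewrite lee_fin exprn_ge0// ltW.
exact: lebesgue_rV_eball_le_sphere_volume.
Qed.

(** The integrand separates, which puts the first term of the bound in (i) into the product form
    given by the splitting. *)
Lemma integral_gauss_tail a :
  \int[lebesgue_rV n]_v \int[mu]_(s in `[a, +oo[)
    (expR (- s ^+ 2 - enorm v ^+ 2))%:E =
  (Num.sqrt pi ^+ n)%:E * gauss_tail a.
Proof.
rewrite -integral_gauss_rV -ge0_integralZr//; last 2 first.
- exact: measurable_gauss_rV.
- exact: gauss_tail_ge0.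
apply: eq_integral => v _; rewrite /gauss_tail -ge0_integralZl//; last first.
  by apply/measurable_EFinP/measurable_funTS; exact: measurable_gauss_fun.
by apply: eq_integral => s _; rewrite addrC expRD EFinM.
Qed.

End collision.

Theorem lemma4p1 (R : realType) (n : nat) (n_gt0 : (0 < n)%N)
    (D : set 'rV[R]_n) (r : R) :
  bounded_set D -> diam D <= r -> D `<=` eball 0 r ->
  (forall z : R, 1 < z ->
    (Omega_dom D z
       <= \int[lebesgue_rV n]_xis
            \int[lebesgue_measure]_(s in `[(z / ln z - r)%R, +oo[)
              (expR (- s ^+ 2 - enorm xis ^+ 2))%:E
          + sphere_volume n * (1 / ln z ^+ n)%:E
            * \int[lebesgue_measure]_(s in `[(- r)%R, +oo[) (expR (- s ^+ 2))%:E
       < +oo)%E) /\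
  (Omega R n < +oo)%E.
Proof.
move=> _ _ Dr; split=> [z z1|].
  have lnz0 : 0 < ln z by rewrite ln_gt0.
  have sv0 : (0 <= @sphere_volume R n)%E by rewrite mule_ge0.
  rewrite integral_gauss_tail -/(gauss_tail (- r)).
  apply/andP; split; last first.
    rewrite lte_add_pinfty//; apply: lte_mul_pinfty.
    - by rewrite lee_fin exprn_ge0// sqrtr_ge0.
    - by [].
    - exact: gauss_tail_fin.
    - by rewrite mule_ge0// lee_fin divr_ge0// exprn_ge0// ltW.
    - rewrite fin_numM// ge0_fin_numE//; exact: sphere_volume_fin.
    - exact: gauss_tail_fin.
  apply: ge_ereal_sup => _ [x _ [xi _ <-]].
  rewrite indicE; case: (boolP (x \in D)) => [/set_mem xD|_].
    (* The cutoff is rho = 1 / ln z: then z rho = z / ln z and rho^n = 1 / ln^n z. *)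
    rewrite mul1e div1r -exprVn; apply: collision_integral_le_split.
    - by rewrite ltW// (lt_trans ltr01).
    - by rewrite invr_gt0.
    - by have := Dr _ xD; rewrite /eball/= sub0r enormN => /ltW.
  (* Outside [D] the indicator makes the left side 0, and the bound is nonnegative. *)
  rewrite mul0e adde_ge0// mule_ge0// ?gauss_tail_ge0//.
  by rewrite mule_ge0// lee_fin divr_ge0// exprn_ge0// ltW.
apply: (@le_lt_trans _ _ (Num.sqrt pi ^+ n.+1)%:E); last exact: ltry.
by apply: ge_ereal_sup => _ [x _ [xi _ <-]]; exact: collision_integral_le.
Qed.
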